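(* Let $v_1=(x_1,y_1)$ and $v_2=(x_2,y_2)$ be distinct points of $A_2$, let $d\ge d^{\rm hex}(v_1,v_2)$ be an integer, $c=d-d^{\rm hex}(v_1,v_2)$, and let ${\cal A}_d(v_1,v_2)$ be the optimal tristance anticode in the hexagonal graph of diameter $d$ centered about $v_1$ and $v_2$. Then ${\cal A}_d(v_1,v_2)$ consists of all $(x,y)\in A_2$ such that $\min\{x_1,x_2\}-c\le x\le\max\{x_1,x_2\}+c$, $\min\{y_1,y_2\}-c\le y\le\max\{y_1,y_2\}+c$, $\min\{x_1-y_1,x_2-y_2\}-c\le x-y\le\max\{x_1-y_1,x_2-y_2\}+c$.
   Context: Let $\omega=-\tfrac12+\tfrac{\sqrt3}{2}i$. The hexagonal lattice is $A_2=\{x+\omega y: x,y\in\mathbb{Z}\}$, and the point $x+\omega y$ is written $(x,y)$. The hexagonal graph has vertex set $A_2$, two points being adjacent iff their Euclidean distance (in $\mathbb{C}$) is $1$; equivalently $(x,y)$ is adjacent to $(x\pm1,y)$, $(x,y\pm1)$, $(x+1,y+1)$, $(x-1,y-1)$. $d^{\rm hex}$ denotes the graph distance and $d^{\rm hex}_3(v_1,v_2,v_3)$ the tristance: the minimum number of edges of a tree in the hexagonal graph (possibly using additional vertices) containing $v_1,v_2,v_3$. A set ${\cal A}\subset A_2$ is a tristance anticode of diameter $d$ centered about $v_1,v_2$ if $d^{\rm hex}_3(v_1,v_2,v)\le d$ for all $v\in{\cal A}$; it is optimal if it has largest possible cardinality among such sets. *)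

(* Defs.v *)
From HB Require Import structures.
From mathcomp Require Import all_boot all_order all_algebra all_field.
From mathcomp Require Import finmap.
From mathcomp Require Import boolp classical_sets functions cardinality.
From mathcomp Require Import ring lra zify.

Set Implicit Arguments.
Unset Strict Implicit.
Unset Printing Implicit Defensive.

Import Order.TTheory GRing.Theory Num.Theory.

Local Open Scope ring_scope.

(* The lattice point x + omega y is represented by its coordinates (x, y). *)
Notation A2 := (int * int)%type.

(* omega = -1/2 + (sqrt 3 / 2) i is algebraic, so algC stands in for the complex
   plane and its norm is the Euclidean one. *)
Definition hex_omega : algC := - 2^-1 + sqrtC 3 / 2 * 'i.

Definition hex_embed (v : A2) : algC := v.1%:~R + hex_omega * v.2%:~R.

Definition hex_adj (u v : A2) : bool := `|hex_embed u - hex_embed v| == 1.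

Lemma hex_omega_norm (x y : int) :
  `|x%:~R + hex_omega * y%:~R| ^+ 2 = (x ^+ 2 - x * y + y ^+ 2)%:~R.
Proof.
have s3 : sqrtC 3 ^+ 2 = 3 :> algC by rewrite sqrtCK.
have s3r : (sqrtC 3 : algC)^* = sqrtC 3.
  by apply: conj_Creal; rewrite ger0_real // sqrtC_ge0 ler0n.
rewrite normCK /hex_omega !(rmorphD, rmorphB, rmorphN, rmorphM, rmorphXn) /=.
rewrite !fmorphV !rmorph_int !rmorph_nat s3r conjCi.
have i2 : 'i ^+ 2 = -1 :> algC by rewrite sqrCi.
set s := sqrtC 3 in s3 *; set X := x%:~R; set Y := y%:~R.
have -> : (X + (- 2^-1 + s / 2 * 'i) * Y) * (X + (- 2^-1 + s / 2 * - 'i) * Y)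
   = (X - Y / 2) ^+ 2 - (s ^+ 2) * ('i ^+ 2) * Y ^+ 2 / 4 by field.
by rewrite i2 s3; field.
Qed.

Lemma hex_adjE (u v : A2) :
  hex_adj u v = ((u.1 - v.1, u.2 - v.2)
    \in ([:: (1, 0); (-1, 0); (0, 1); (0, -1); (1, 1); (-1, -1)] : seq A2)).
Proof.
have -> : hex_adj u v = ((u.1 - v.1) ^+ 2 - (u.1 - v.1) * (u.2 - v.2)
                         + (u.2 - v.2) ^+ 2 == 1).
  rewrite /hex_adj -(@eqrXn2 _ 2%N) ?normr_ge0 ?ler01 // expr1n.
  have -> : hex_embed u - hex_embed v
      = (u.1 - v.1)%:~R + hex_omega * (u.2 - v.2)%:~R.
    by rewrite /hex_embed !intrB; ring.
  by rewrite hex_omega_norm -(eqr_int algC).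
move: (u.1 - v.1) (u.2 - v.2) => x y.
rewrite !inE !xpair_eqE.
apply/eqP/idP => [h|].
  have bound (a b : int) : a ^+ 2 - a * b + b ^+ 2 = 1 -> -1 <= a <= 1.
    move=> hab; have : 0 <= (2 * b - a) ^+ 2 by exact: sqr_ge0.
    have -> : (2 * b - a) ^+ 2 = 4 * (a ^+ 2 - a * b + b ^+ 2) - 3 * (a * a).
      by ring.
    by rewrite hab => ?; apply/andP; split; nia.
  have hx := bound _ _ h.
  have hy : -1 <= y <= 1 by apply: (bound y x); rewrite -h; ring.
  have cases (a : int) : -1 <= a <= 1 -> [\/ a = -1, a = 0 | a = 1].
    move=> /andP[? ?]; have [?|[?|?]] : a = -1 \/ (a = 0 \/ a = 1) by lia.
    - exact: Or31.
    - exact: Or32.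
    - exact: Or33.
  by move: h; case: (cases _ hx) => ->; case: (cases _ hy) => ->.
by move=> /or4P[|||/or3P[]] /andP[/eqP-> /eqP->].
Qed.

Definition hex_walk_of_length (u v : A2) (n : nat) : Prop :=
  exists s : seq A2, [/\ path hex_adj u s, last u s = v & size s = n].

(* A finite graph (V, E) with E a set of two-element sets {p, q}. *)
Definition edge_rel (E : {fset {fset A2}}) : rel A2 :=
  fun p q => [fset p; q]%fset \in E.

Definition hex_subgraph (V : {fset A2}) (E : {fset {fset A2}}) : Prop :=
  forall e, e \in E -> exists p q : A2,
    [/\ p \in V, q \in V, hex_adj p q & e = [fset p; q]%fset].

Definition graph_connected (V : {fset A2}) (E : {fset {fset A2}}) : Prop :=
  V != fset0 /\ forall p q, p \in V -> q \in V ->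
    exists s, path (edge_rel E) p s /\ last p s = q.

Definition graph_acyclic (E : {fset {fset A2}}) : Prop :=
  forall s : seq A2, (2 < size s)%N -> ~ ucycle (edge_rel E) s.

Definition hex_tree (V : {fset A2}) (E : {fset {fset A2}}) : Prop :=
  [/\ hex_subgraph V E, graph_connected V E & graph_acyclic E].

Definition hex_tree_with_edges (v1 v2 v3 : A2) (n : nat) : Prop :=
  exists V E, [/\ hex_tree V E, [/\ v1 \in V, v2 \in V & v3 \in V]
                & #|` E| = n].

Lemma hex_adj_sym : symmetric hex_adj.
Proof. by move=> u v; rewrite /hex_adj distrC. Qed.

Lemma edge_rel_sym E : symmetric (edge_rel E).
Proof. by move=> u v; rewrite /edge_rel fsetUC. Qed.

Lemma hex_adj_neq u v : hex_adj u v -> u != v.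
Proof.
apply: contraTneq => ->.
by rewrite /hex_adj subrr normr0 eq_sym oner_eq0.
Qed.

Lemma hex_line (k : int * int) (hk : forall u : A2, hex_adj u (u + k))
  (u : A2) (n : nat) : exists s, path hex_adj u s /\ last u s = u + k *+ n.
Proof.
elim: n u => [|n IH] u; first by exists [::]; rewrite mulr0n addr0.
have [s [ps ls]] := IH (u + k).
by exists (u + k :: s); rewrite /= hk ps ls mulrS addrA.
Qed.

Lemma hex_walk_exists (u v : A2) :
  exists s, path hex_adj u s /\ last u s = v.
Proof.
have step k : k \in ([:: (1, 0); (-1, 0); (0, 1); (0, -1)] : seq A2) ->
    forall u : A2, hex_adj u (u + k).
  by move=> hk [a b]; move: hk; rewrite hex_adjE !inE => /or4P[] /eqP-> /=;
     rewrite !opprD !addrA !subrr !sub0r.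
have hx (w : A2) (m : int) : exists s, path hex_adj w s /\ last w s = w + (m, 0).
  case: m => n.
    have [s [ps ls]] := hex_line (step (1, 0) isT) w n; exists s; split => //.
    by rewrite ls; congr (_ + _); apply/eqP; rewrite -pair_eqE /= !pairMnE /=; lia.
  have [s [ps ls]] := hex_line (step (-1, 0) isT) w n.+1; exists s; split => //.
  by rewrite ls; congr (_ + _); apply/eqP; rewrite -pair_eqE /= !pairMnE /=; lia.
have hy (w : A2) (m : int) : exists s, path hex_adj w s /\ last w s = w + (0, m).
  case: m => n.
    have [s [ps ls]] := hex_line (step (0, 1) isT) w n; exists s; split => //.
    by rewrite ls; congr (_ + _); apply/eqP; rewrite -pair_eqE /= !pairMnE /=; lia.
  have [s [ps ls]] := hex_line (step (0, -1) isT) w n.+1; exists s; split => //.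
  by rewrite ls; congr (_ + _); apply/eqP; rewrite -pair_eqE /= !pairMnE /=; lia.
have [s [ps ls]] := hx u (v.1 - u.1).
have [t [pt lt]] := hy (last u s) (v.2 - u.2).
exists (s ++ t); rewrite cat_path ps pt last_cat lt ls; split => //.
by apply/eqP; rewrite -pair_eqE /=; lia.
Qed.

Lemma hex_tree_point v : hex_tree [fset v]%fset fset0.
Proof.
split.
- by move=> e; rewrite inE.
- split; first by apply/fset0Pn; exists v; rewrite inE.
  by move=> p q; rewrite !inE => /eqP-> /eqP->; exists [::].
- by move=> [|a [|b s]] //= _ /andP[]; rewrite /edge_rel inE.
Qed.

Lemma hex_tree_leaf V E p q : hex_tree V E -> p \in V -> q \notin V ->
  hex_adj p q -> hex_tree (q |` V)%fset ([fset p; q] |` E)%fset.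
Proof.
move=> [sub [ne con] acy] pV qV pq.
set E' := (_ |` E)%fset.
have endV x y : edge_rel E x y -> x \in V /\ y \in V.
  move=> /sub[a [b [aV bV _ /fsetP exy]]].
  have := exy x; have := exy y; rewrite !inE !eqxx orbT /= => hy hx.
  by split; [case/esym/orP: hx | case/esym/orP: hy] => /eqP->.
have subE : subrel (edge_rel E) (edge_rel E').
  by move=> x y; rewrite /edge_rel !inE => ->; rewrite orbT.
have nbr x y : edge_rel E' x y -> edge_rel E x y \/
    (x = p /\ y = q \/ x = q /\ y = p).
  rewrite /edge_rel in_fsetU in_fset1 => /orP[/eqP/fsetP exy|]; last by left.
  right; have npq := hex_adj_neq pq.
  have := exy x; have := exy y; have := exy p; have := exy q.
  rewrite !inE !eqxx /= !orbT /= => hq hp hy hx.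
  case/orP: hp => /eqP hp; case/orP: hq => /eqP hq.
  - by rewrite hp hq eqxx in npq.
  - by left.
  - by right.
  - by rewrite hp hq eqxx in npq.
have pqE' : edge_rel E' p q by rewrite /edge_rel !inE eqxx.
have con' x : x \in (q |` V)%fset ->
    exists s, path (edge_rel E') p s /\ last p s = x.
  rewrite in_fset1U => /orP[/eqP->|xV].
    by exists [:: q]; rewrite /= pqE'.
  have [s [ps ls]] := con p x pV xV.
  by exists s; rewrite (sub_path subE).
split.
- move=> e; rewrite in_fset1U => /orP[/eqP->|/sub[a [b [aV bV ab ->]]]].
    by exists p, q; rewrite !in_fset1U eqxx pV orbT.
  by exists a, b; rewrite !in_fset1U aV bV !orbT.
- split; first by apply/fset0Pn; exists q; rewrite !inE eqxx.
  move=> x y /con'[s [ps ls]] /con'[t [pt lt]].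
  exists (rev (belast p s) ++ t); rewrite cat_path last_cat.
  have -> : last x (rev (belast p s)) = p.
    case: s {ps} ls => [|a s] //= ls.
    by rewrite rev_cons last_rcons.
  by rewrite pt lt andbT -{1}ls rev_path (eq_path (e' := edge_rel E')) //
    => a b; rewrite edge_rel_sym.
- move=> s s3 /andP[cs us].
  have [qs|qs] := boolP (q \in s); last first.
    apply: (acy s s3); rewrite /ucycle us andbT.
    apply: (sub_in_cycle (P := [pred x | x != q])) cs; last first.
      by apply/allP => x xs /=; apply: contraNneq qs => <-.
    move=> x y /= /eqP xq /eqP yq /nbr[//|[[_ /yq]|[/xq]]] //.
  have [i t et] := rot_to qs.
  move: s3 us cs; rewrite -(size_rot i) -(rot_uniq i) -(rot_cycle i) et.
  case/lastP: t {et} => [|t b] //.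
  case: t => [|a t] //= _ /and3P[_ abt _].
  rewrite rcons_path last_rcons => /andP[qa /andP[_ bq]].
  have nbrq x : edge_rel E' q x -> x = p.
    case/nbr => [/endV[qV' _]|[[qp _]|[_ ->//]]]; first by rewrite qV' in qV.
    by rewrite qp pV in qV.
  by move: abt; rewrite (nbrq _ qa) (nbrq b) 1?edge_rel_sym // mem_rcons inE eqxx.
Qed.

Lemma hex_tree_walk V E u s : hex_tree V E -> u \in V -> path hex_adj u s ->
  exists V' E', [/\ hex_tree V' E', (V `<=` V')%fset & last u s \in V'].
Proof.
elim: s V E u => [|a s IH] V E u tVE uV /=; first by exists V, E.
case/andP=> ua ps; have [aV|aV] := boolP (a \in V); first exact: (IH V E).
have tl := hex_tree_leaf tVE uV aV ua.
have [|V' [E' [t' s' l']]] := IH _ _ a tl _ ps; first by rewrite !inE eqxx.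
exists V', E'; split => //.
by apply: fsubset_trans s'; exact: fsubsetU1.
Qed.

Lemma hex_dist_subproof u v : exists n, `[< hex_walk_of_length u v n >].
Proof.
have [s [ps ls]] := hex_walk_exists u v.
by exists (size s); apply/asboolP; exists s.
Qed.

Definition hex_dist (u v : A2) : nat := ex_minn (hex_dist_subproof u v).

Lemma hex_tristance_subproof v1 v2 v3 :
  exists n, `[< hex_tree_with_edges v1 v2 v3 n >].
Proof.
have [s [ps ls]] := hex_walk_exists v1 v2.
have [t [pt lt]] := hex_walk_exists v2 v3.
have v1V : v1 \in [fset v1]%fset by rewrite inE.
have [V [E [tVE sV lV]]] := hex_tree_walk (hex_tree_point v1) v1V ps.
rewrite ls in lV.
have [V' [E' [tVE' sV' lV']]] := hex_tree_walk tVE lV pt.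
rewrite lt in lV'.
exists #|` E'|; apply/asboolP; exists V', E'; split => //; split => //.
- by apply: (fsubsetP sV'); apply: (fsubsetP sV).
- exact: (fsubsetP sV').
Qed.

Definition hex_tristance (v1 v2 v3 : A2) : nat :=
  ex_minn (hex_tristance_subproof v1 v2 v3).

Definition tristance_anticode (d : int) (v1 v2 : A2) (A : set A2) : Prop :=
  forall v, A v -> (hex_tristance v1 v2 v)%:Z <= d.

(* [B #<= A] compares cardinalities of arbitrary, possibly infinite, sets. *)
Definition optimal_tristance_anticode (d : int) (v1 v2 : A2) (A : set A2) :
    Prop :=
  tristance_anticode d v1 v2 A /\
  forall B : set A2, tristance_anticode d v1 v2 B -> (B #<= A)%card.

(* Main.v *)
(** Write [x], [y] and [z = x - y] for the three coordinates of a point; the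
    graph distance is half the sum of the coordinate differences.

    A point [v] of the claimed hexagon is within [c] of some [m] lying on a
    geodesic from [v1] to [v2], so three geodesics out of [m] give a tree with
    at most [d] edges.  Conversely, let [phi] be one of [x], [-x], [y], [-y],
    [z], [-z], and let [m] maximize [phi] on a simple path from [v1] to [v2] in
    a tree through [v1], [v2], [v].  The detour through [m] makes this path
    longer than the distance by at least [phi m - max (phi v1) (phi v2)], and
    reaching [v] costs at least [phi v - phi m] further edges, one for each
    level of [phi] above the path.  So the hexagon is the set of all admissible
    points; being finite, it is the only optimal anticode. *)
Require Import Defs.
From mathcomp Require Import all_boot all_order all_algebra finmap.
From mathcomp Require Import boolp classical_sets cardinality.
From mathcomp Require Import ring zify.

Set Implicit Arguments.
Unset Strict Implicit.
Unset Printing Implicit Defensive.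

Import Order.TTheory GRing.Theory Num.Theory.
Local Open Scope ring_scope.
Local Open Scope classical_set_scope.

(** * Graph distance in coordinates *)

(** Twice the graph distance, left undivided to stay within linear integer arithmetic. *)
Definition hex_width (u v : A2) : int :=
  `|u.1 - v.1| + `|u.2 - v.2| + `|(u.1 - v.1) - (u.2 - v.2)|.

Lemma hex_width_triangle (u v w : A2) :
  hex_width u w <= hex_width u v + hex_width v w.
Proof. rewrite /hex_width; lia. Qed.

Lemma hex_adj_width (u v : A2) : hex_adj u v = (hex_width u v == 2).
Proof.
rewrite hex_adjE /hex_width !inE !xpair_eqE; lia.
Qed.

Lemma hex_walk_width (u : A2) (s : seq A2) :
  path hex_adj u s -> hex_width u (last u s) <= 2 * (size s)%:Z.
Proof.
elim: s u => [|a s IH] u /=; first by rewrite /hex_width; lia.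
rewrite hex_adj_width => /andP[/eqP ua /IH].
have := hex_width_triangle u a (last a s); lia.
Qed.

Lemma hex_width_walk (u v : A2) (n : nat) :
  hex_width u v = 2 * n%:Z -> hex_walk_of_length u v n.
Proof.
case: v => x y; elim: n u => [|n IH] [a b] h.
  exists [::]; split => //=; move: h; rewrite /hex_width /= => h.
  by apply/eqP; rewrite xpair_eqE; lia.
have [w [aw wv]] : exists w, hex_adj (a, b) w /\ hex_width w (x, y) = 2 * n%:Z.
  (* A greedy step: each case lowers two of the three coordinate differences by one and keeps the
     third. *)
  pose w : A2 := if (a < x) && (b < y) then (a + 1, b + 1)
    else if (x < a) && (y < b) then (a - 1, b - 1)
    else if a < x then (a + 1, b) else if x < a then (a - 1, b)
    else if b < y then (a, b + 1) else (a, b - 1).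
  exists w; rewrite hex_adj_width; move: h; rewrite /w /hex_width /=.
  by do ?case: ifP => /=; lia.
have [s [ps ls ss]] := IH w wv.
by exists (w :: s); split; rewrite /= ?aw ?ss.
Qed.

Lemma hex_distE (u v : A2) : 2 * (hex_dist u v)%:Z = hex_width u v.
Proof.
rewrite /hex_dist; case: ex_minnP => n /asboolP [s [ps ls ss]] nmin.
have le_n := hex_walk_width ps; rewrite ls ss in le_n.
have := hex_width_walk (u := u) (v := v).
(* The largest of the three absolute differences is the sum of the other two, so the width is twice
   that maximum. *)
have [k hk] : exists k : nat, hex_width u v = 2 * k%:Z.
  exists (maxn (maxn `|(u.1 - v.1)%R|%N `|(u.2 - v.2)%R|%N)
    `|(u.1 - v.1 - (u.2 - v.2))%R|%N).
  by rewrite /hex_width; lia.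
by move=> /(_ k hk) /asboolP /nmin; lia.
Qed.

(** * Upper bound for the tristance *)

(** Each step of the walk stays in the tree or attaches a leaf, at the cost of at most one edge. *)
Lemma hex_tree_walk_card (V : {fset A2}) (E : {fset {fset A2}}) (u : A2)
    (s : seq A2) : hex_tree V E -> u \in V -> path hex_adj u s ->
  exists V' E', [/\ hex_tree V' E', (V `<=` V')%fset, last u s \in V' &
                  (#|` E'| <= #|` E| + size s)%N].
Proof.
elim: s V E u => [|a s IH] V E u tVE uV /=.
  by exists V, E; split=> //; rewrite addn0.
case/andP=> ua ps; have [aV|aV] := boolP (a \in V).
  have [V' [E' [tV' sV' lV' cE']]] := IH V E a tVE aV ps.
  by exists V', E'; split; rewrite // addnS leqW.
have tl := hex_tree_leaf tVE uV aV ua.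
have [|V' [E' [tV' sV' lV' cE']]] := IH _ _ a tl _ ps; first exact: fset1U1.
exists V', E'; split=> //; first exact: fsubset_trans (fsubsetU1 _ _) sV'.
apply: leq_trans cE' _; rewrite addnS -addSn leq_add2r cardfsU1.
by case: (_ \notin _); rewrite /= ?ltnS ?leqnSn.
Qed.

Lemma hex_tristance_le_star (m v1 v2 v3 : A2) :
  2 * (hex_tristance v1 v2 v3)%:Z
    <= hex_width v1 m + hex_width m v2 + hex_width m v3.
Proof.
have [s1 [ps1 ls1 ss1]] := hex_width_walk (esym (hex_distE v1 m)).
have [s2 [ps2 ls2 ss2]] := hex_width_walk (esym (hex_distE m v2)).
have [s3 [ps3 ls3 ss3]] := hex_width_walk (esym (hex_distE m v3)).
have v1V : v1 \in [fset v1]%fset by rewrite inE.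
have [V [E [tV sV mV cE]]] := hex_tree_walk_card (hex_tree_point v1) v1V ps1.
rewrite ls1 in mV.
have [V' [E' [tV' sV' v2V' cE']]] := hex_tree_walk_card tV mV ps2.
have [V'' [E'' [tV'' sV'' v3V'' cE'']]] :=
  hex_tree_walk_card tV' (fsubsetP sV' _ mV) ps3.
rewrite ls2 in v2V'; rewrite ls3 in v3V''.
have treeE : hex_tree_with_edges v1 v2 v3 #|` E''|.
  exists V'', E''; split=> //; split=> //; last exact: (fsubsetP sV'').
  by apply/(fsubsetP sV'')/(fsubsetP sV')/(fsubsetP sV).
rewrite /hex_tristance; case: ex_minnP => n _ /(_ _ (asboolT treeE)).
by rewrite -!hex_distE; move: cE; rewrite cardfs0; lia.
Qed.

(** * Lower bound for the tristance *)

Lemma edge_rel_adj (V : {fset A2}) (E : {fset {fset A2}}) :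
  hex_subgraph V E -> subrel (edge_rel E) hex_adj.
Proof.
move=> sub p q /sub[a [b [_ _ ab epq]]].
have := fset21 p q; have := fset22 p q; have := fset21 a b; have := fset22 a b.
rewrite epq -{1 2}epq => /fset2P eb /fset2P ea /fset2P eq /fset2P ep.
have nab := hex_adj_neq ab.
case: ep eq ea eb => -> [] -> => [|_ _|_ _|].
- by move=> _ [] eb; rewrite eb eqxx in nab.
- by [].
- by rewrite hex_adj_sym.
- by move=> [] ea; rewrite ea eqxx in nab.
Qed.

(** The last conjunct drives the induction: edges of the tail avoid [u], so the first edge is new.
    It later bounds [phi] on [F]. *)
Lemma uniq_path_edges (E : {fset {fset A2}}) (u : A2) (s : seq A2) :
  path (edge_rel E) u s -> uniq (u :: s) ->
  exists F : {fset {fset A2}}, [/\ (F `<=` E)%fset, #|` F| = size s &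
    forall e p, e \in F -> p \in e -> p \in u :: s].
Proof.
elim: s u => [|a s IH] u.
  by exists fset0; split=> // [|e p]; rewrite ?fsub0set ?cardfs0 ?inE.
rewrite [path _ _ _]/= [uniq _]/= => /andP[ua pas] /andP[us uas].
have [F [FE cF Fs]] := IH _ pas uas.
exists ([fset u; a] |` F)%fset; split.
- by rewrite fsubUset fsub1set FE andbT.
- rewrite cardfsU1 cF /=.
  suff -> : [fset u; a]%fset \notin F by [].
  by apply: contra us => /Fs; apply; exact: fset21.
- move=> e p /fset1UP[-> /fset2P[] ->|eF pe].
  + exact: mem_head.
  + by rewrite !inE eqxx orbT.
  + by rewrite in_cons (Fs _ _ eF pe) orbT.
Qed.

(** A step above level [h] uses an edge outside [F]. Adding it to [F] and raising [h] by one keeps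
    the hypotheses, so each new level costs an edge of its own. *)
Lemma card_edges_climb (E F : {fset {fset A2}}) (phi : A2 -> int) (h : int)
    (u : A2) (s : seq A2) :
  (forall p q, edge_rel E p q -> phi q <= phi p + 1) ->
  path (edge_rel E) u s -> (F `<=` E)%fset ->
  (forall e p, e \in F -> p \in e -> phi p <= h) -> phi u <= h ->
  phi (last u s) + (#|` F|)%:Z <= h + (#|` E|)%:Z.
Proof.
move=> lip; elim: s u h F => [|a s IH] u h F /=.
  by move=> _ /fsubset_leq_card cFE _ uh; exact: lerD.
case/andP=> ua pas FE Fh uh.
have [ah|ah] := leP (phi a) h; first exact: IH pas FE Fh ah.
have := lip _ _ ua => la.
have nF : [fset u; a]%fset \notin F.
  by apply/negP => /Fh /(_ (fset22 u a)); lia.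
suff : phi (last a s) + (#|` ([fset u; a] |` F)%fset|)%:Z
    <= (h + 1) + (#|` E|)%:Z.
  by rewrite cardfsU1 nF; move: #|` F| #|` E| => f e /=; lia.
apply: (IH a (h + 1)) => //; last by lia.
- by rewrite fsubUset fsub1set FE andbT.
- by move=> e p /fset1UP[-> /fset2P[] ->|eF pe]; last have := Fh _ _ eF pe; lia.
Qed.

Lemma seq_argmax (T : eqType) (phi : T -> int) (u : T) (s : seq T) :
  exists2 m, m \in u :: s & forall p, p \in u :: s -> phi p <= phi m.
Proof.
elim: s u => [|a s IH] u.
  by exists u => [|p]; rewrite inE // => /eqP ->.
have [m ms mP] := IH a; have [um|um] := leP (phi u) (phi m).
  by exists m => [|p]; rewrite in_cons ?ms ?orbT // => /predU1P[->|/mP].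
exists u => [|p]; first exact: mem_head.
by rewrite in_cons => /predU1P[->|/mP] //; lia.
Qed.

Lemma hex_tristance_ge_excess (phi : A2 -> int) (v1 v2 v : A2) :
  (forall p q, hex_adj p q -> phi q <= phi p + 1) ->
  (forall m, hex_width v1 v2 + 2 * (phi m - Num.max (phi v1) (phi v2))
     <= hex_width v1 m + hex_width m v2) ->
  hex_width v1 v2 + 2 * (phi v - Num.max (phi v1) (phi v2))
    <= 2 * (hex_tristance v1 v2 v)%:Z.
Proof.
move=> lip detour; rewrite /hex_tristance.
case: ex_minnP => n /asboolP[V [E [[sub [_ con] _] [v1V v2V vV] <-]]] _.
have lipE p q : edge_rel E p q -> phi q <= phi p + 1.
  by move=> /(edge_rel_adj sub)/lip.
have [s0 [/shortenP[s ps us _] ls]] := con _ _ v1V v2V.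
have [F [FE cF Fs]] := uniq_path_edges ps us.
have [m ms mP] := seq_argmax phi v1 s.
have [t [pt lt]] := con _ _ v1V vV.
have climb := card_edges_climb lipE pt FE
  (fun e p eF pe => mP p (Fs e p eF pe)) (mP v1 (mem_head _ _)).
have {}ps := sub_path (edge_rel_adj sub) ps.
(* Splitting the path at [m] bounds its length below by [detour]; added to [climb], this cancels
   [phi m]. *)
have := detour m; rewrite lt cF in climb.
move: ps ls climb; case/splitPl: ms => s1 s2 lm.
rewrite cat_path last_cat lm => /andP[/hex_walk_width + /hex_walk_width].
by rewrite size_cat lm => + + l2; rewrite l2; lia.
Qed.

(** * Finiteness and geometry of the hexagon *)

Lemma finite_card_le_eq (T : choiceType) (A B : set T) :
  finite_set B -> A `<=` B -> (B #<= A)%card -> A = B.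
Proof.
move=> finB AB BA; have finA := sub_finite_set AB finB.
rewrite -(fset_setK finA) -(fset_setK finB).
suff -> : fset_set A = fset_set B by [].
apply/eqP; rewrite eqEfcard; apply/andP.
split; first by rewrite -fset_set_sub.
have [n Bn] := finB; rewrite (card_fset_set Bn); apply: leq_card_fset_set => //.
by rewrite -(card_le_eql Bn).
Qed.

(** For [c = 0] this is the union of the geodesics from [v1] to [v2]. *)
Definition hex_hull (v1 v2 : A2) (c : int) : set A2 :=
  [set p : A2 |
    let: (x, y) := p in
    [/\ Num.min v1.1 v2.1 - c <= x <= Num.max v1.1 v2.1 + c,
        Num.min v1.2 v2.2 - c <= y <= Num.max v1.2 v2.2 + c &
        Num.min (v1.1 - v1.2) (v2.1 - v2.2) - c <= x - y
          <= Num.max (v1.1 - v1.2) (v2.1 - v2.2) + c]].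

Lemma finite_hex_hull (v1 v2 : A2) (c : int) : finite_set (hex_hull v1 v2 c).
Proof.
have finI (a b : int) : finite_set [set x : int | a <= x <= b].
  apply: (@sub_finite_set _ _ [set a + i%:Z | i in `I_(`|b - a|.+1)]).
    by move=> x /= axb; exists `|x - a|%N => /=; lia.
  exact: finite_image (finite_II _).
apply: sub_finite_set (finite_setX
  (finI (Num.min v1.1 v2.1 - c) (Num.max v1.1 v2.1 + c))
  (finI (Num.min v1.2 v2.2 - c) (Num.max v1.2 v2.2 + c))).
by move=> [x y] [hx hy _].
Qed.

Lemma difference_constraints (a1 a2 b1 b2 c1 c2 : int) :
  a1 <= a2 -> b1 <= b2 -> c1 <= c2 -> a1 - b2 <= c2 -> c1 <= a2 - b1 ->
  exists x y, [/\ a1 <= x <= a2, b1 <= y <= b2 & c1 <= x - y <= c2].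
Proof.
move=> a12 b12 c12 abc cab; pose x := Num.max a1 (c1 + b1).
(* The least solution: [x] leaves room for some [y >= b1] with [c1 <= x - y], and [y] is then as
   small as possible. *)
by exists x, (Num.max b1 (x - c2)); split; rewrite /x; lia.
Qed.

Lemma dist_between (a b m : int) :
  Num.min a b <= m <= Num.max a b -> `|a - m| + `|m - b| = `|a - b|.
Proof. lia. Qed.

(** The union of geodesics and the ball of radius [c] around [v] are both cut out by intervals for
    [x], [y] and [x - y]; [m] is a common point. *)
Lemma hex_hull_retract (v1 v2 v : A2) (c : int) : 0 <= c ->
  hex_hull v1 v2 c v ->
  exists m, hex_width v1 m + hex_width m v2 = hex_width v1 v2 /\
            hex_width m v <= 2 * c.
Proof.
case: v1 v2 v => [x1 y1] [x2 y2] [x y] c0 [/= hx hy hz].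
have [x12 y12 z12] : [/\ Num.min x1 x2 <= Num.max x1 x2,
    Num.min y1 y2 <= Num.max y1 y2 &
    Num.min (x1 - y1) (x2 - y2) <= Num.max (x1 - y1) (x2 - y2)].
  by split; lia.
(* These six bounds make the intersection with the ball around [v] nonempty;
   each holds because an extreme coordinate is attained at [v1] or [v2]. *)
have [z1_ge z2_le] :
    Num.min x1 x2 - Num.max y1 y2 <= Num.min (x1 - y1) (x2 - y2) /\
    Num.max (x1 - y1) (x2 - y2) <= Num.max x1 x2 - Num.min y1 y2.
  by split; lia.
have [z2l z2r] :
    Num.min x1 x2 - Num.min y1 y2 <= Num.max (x1 - y1) (x2 - y2) /\
    Num.max x1 x2 - Num.max y1 y2 <= Num.max (x1 - y1) (x2 - y2).
  by split; lia.
have [z1l z1r] :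
    Num.min (x1 - y1) (x2 - y2) <= Num.min x1 x2 - Num.min y1 y2 /\
    Num.min (x1 - y1) (x2 - y2) <= Num.max x1 x2 - Num.max y1 y2.
  by split; lia.
have [mx [my [hmx hmy hmz]]] : exists mx my,
  [/\ Num.max (Num.min x1 x2) (x - c) <= mx <= Num.min (Num.max x1 x2) (x + c),
      Num.max (Num.min y1 y2) (y - c) <= my <= Num.min (Num.max y1 y2) (y + c) &
      Num.max (Num.min (x1 - y1) (x2 - y2)) (x - y - c) <= mx - my
        <= Num.min (Num.max (x1 - y1) (x2 - y2)) (x - y + c)].
  move: x12 y12 z12 z1_ge z2_le z2l z2r z1l z1r hx hy hz.
  move: (Num.min x1 x2) (Num.max x1 x2) (Num.min y1 y2) (Num.max y1 y2)
    (Num.min (x1 - y1) _) (Num.max (x1 - y1) _) => a1 a2 b1 b2 z1 z2 *.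
  by apply: difference_constraints; lia.
exists (mx, my).
have split_bounds (p q r t : int) :
    Num.max p (t - c) <= r <= Num.min q (t + c) ->
    p <= r <= q /\ `|r - t| <= c.
  rewrite ge_max le_min ler_distl => /andP[/andP[-> ->]].
  by move=> /andP[-> ->].
have [/dist_between dx bx] := split_bounds _ _ _ _ hmx.
have [/dist_between dy by'] := split_bounds _ _ _ _ hmy.
have [/dist_between dz bz] := split_bounds _ _ _ _ hmz.
have subC (a b p q : int) : a - b - (p - q) = a - p - (b - q) by lia.
rewrite /hex_width /=; split.
  by rewrite !(subC _ _ y1) (subC _ _ my) -dx -dy -dz; ring.
(* The width is twice the largest of the three differences, each at most [c]. *)
rewrite subC in bz; move: (mx - x) (my - y) bx by' bz => p q; clear; lia.
Qed.

(** * Anticodes as subsets of the hexagon *)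

Lemma hex_tristance_le_hull (v1 v2 v : A2) (d : int) :
  (hex_dist v1 v2)%:Z <= d ->
  (hex_tristance v1 v2 v)%:Z <= d <->
  hex_hull v1 v2 (d - (hex_dist v1 v2)%:Z) v.
Proof.
move=> d12; have wE := hex_distE v1 v2; split=> [tri|hv]; last first.
  have [|m [m12 mv]] := hex_hull_retract _ hv; first by lia.
  by have := hex_tristance_le_star m v1 v2 v; lia.
have bound (phi : A2 -> int) :
    (forall p q, hex_width p q = 2 -> phi q <= phi p + 1) ->
    (forall m, hex_width v1 v2 + 2 * (phi m - Num.max (phi v1) (phi v2))
       <= hex_width v1 m + hex_width m v2) ->
    phi v <= Num.max (phi v1) (phi v2) + (d - (hex_dist v1 v2)%:Z).
  move=> lip detour.
  have lip_adj p q : hex_adj p q -> phi q <= phi p + 1.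
    by rewrite hex_adj_width => /eqP/lip.
  by have := hex_tristance_ge_excess v lip_adj detour; lia.
(* For each of these [phi], the detour excess comes from its own coordinate; the other two obey the
   triangle inequality. *)
have x_le := bound (fun p => p.1); have x_ge := bound (fun p => - p.1).
have y_le := bound (fun p => p.2); have y_ge := bound (fun p => - p.2).
have z_le := bound (fun p => p.1 - p.2).
have z_ge := bound (fun p => p.2 - p.1).
rewrite (surjective_pairing v) /hex_hull /=.
move: (d - _) {bound wE d12 tri} x_le x_ge y_le y_ge z_le z_ge => c.
rewrite /hex_width => x_le x_ge y_le y_ge z_le z_ge.
split; apply/andP; split.
- have {}x_ge : - v.1 <= Num.max (- v1.1) (- v2.1) + c.
    by apply: x_ge => [p q|m]; clear; lia.
  by move: x_ge; clear; lia.
- by apply: x_le => [p q|m]; clear; lia.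
- have {}y_ge : - v.2 <= Num.max (- v1.2) (- v2.2) + c.
    by apply: y_ge => [p q|m]; clear; lia.
  by move: y_ge; clear; lia.
- by apply: y_le => [p q|m]; clear; lia.
- have {}z_ge : v.2 - v.1 <= Num.max (v1.2 - v1.1) (v2.2 - v2.1) + c.
    by apply: z_ge => [p q|m]; clear; lia.
  by move: z_ge; clear; lia.
- by apply: z_le => [p q|m]; clear; lia.
Qed.

Theorem theorem24 (x1 y1 x2 y2 d : int) (A : set A2) :
  (x1, y1) <> (x2, y2) ->
  (hex_dist (x1, y1) (x2, y2))%:Z <= d ->
  let c : int := d - (hex_dist (x1, y1) (x2, y2))%:Z in
  optimal_tristance_anticode d (x1, y1) (x2, y2) A <->
  A = [set p : A2 |
    let: (x, y) := p in
    [/\ Num.min x1 x2 - c <= x <= Num.max x1 x2 + c,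
        Num.min y1 y2 - c <= y <= Num.max y1 y2 + c &
        Num.min (x1 - y1) (x2 - y2) - c <= x - y
          <= Num.max (x1 - y1) (x2 - y2) + c]].
Proof.
move=> _ dist_le_d c; rewrite -/(hex_hull (x1, y1) (x2, y2) c).
have hullP v := hex_tristance_le_hull v dist_le_d.
have anti B : tristance_anticode d (x1, y1) (x2, y2) B <->
    B `<=` hex_hull (x1, y1) (x2, y2) c.
  by split=> BP v /BP /hullP.
split=> [[/anti A_hull A_max]|->].
  apply: finite_card_le_eq A_hull (A_max _ _); first exact: finite_hex_hull.
  exact/anti.
by split=> [|B /anti]; [exact/anti | exact: subset_card_le].
Qed.
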